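(* Let $\mathbf{P}$ be a small category whose set of objects $P$ has a measure $\mu$, let $\mathbf{A}$ be an abelian category, let $\mathcal{O}$ be a class of objects of $\mathbf{A}$ containing $0$ and closed under isomorphism, and let $w$ be a weight on $\mathcal{O}$. If $w$ is an exact weight on $\mathcal{O}$, then $\mu\circ w$ is an exact weight on $\mathcal{T}_{\mathcal{O},\mu,w}$.
   Context: A weight on a class $\mathcal{O}$ of objects (containing $0$ and closed under isomorphism) of an abelian category is an assignment of $w(A)\in[0,\infty]$ to each $A\in\mathcal{O}$ such that $w(0)=0$ and $w(A)=w(B)$ whenever $A\cong B$. It is exact if for each short exact sequence $0\to A\to B\to C\to0$ with $A,B,C\in\mathcal{O}$ one has $w(A)\le w(B)+w(C)$, $w(B)\le w(A)+w(C)$ and $w(C)\le w(A)+w(B)$. A persistence module is a functor $M:\mathbf{P}\to\mathbf{A}$; these form the abelian category $\mathbf{A}^{\mathbf{P}}$. $\mathcal{T}_{\mathcal{O},\mu,w}$ is the class of persistence modules $M$ such that $M(p)\in\mathcal{O}$ for all $p\in P$ and the function $w(M):P\to[0,\infty]$, $p\mapsto w(M(p))$, is $\mu$-integrable (measurable with finite integral). For such $M$, $(\mu\circ w)(M)=\int_P w(M)\,d\mu$. *)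

(* Defs.v *)
From HB Require Import structures.
From mathcomp Require Import all_boot all_order all_algebra.
From mathcomp Require Import all_classical all_reals all_analysis.

Set Implicit Arguments.
Unset Strict Implicit.
Unset Printing Implicit Defensive.

Import Order.TTheory GRing.Theory Num.Theory.

Local Open Scope classical_set_scope.
Local Open Scope ring_scope.

Record category (ob : Type) : Type := Category {
  hom : ob -> ob -> Type;
  idm : forall a, hom a a;
  comp : forall a b c, hom b c -> hom a b -> hom a c;
  comp1m : forall a b (f : hom a b), comp (idm b) f = f;
  compm1 : forall a b (f : hom a b), comp f (idm a) = f;
  compA : forall a b c d (h : hom c d) (g : hom b c) (f : hom a b),
    comp h (comp g f) = comp (comp h g) f
}.
Arguments idm {ob} C a : rename.
Arguments comp {ob} {C a b c} g f : rename.

Section CategoryNotions.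
Variables (ob : Type) (C : category ob).
Implicit Types (a b c x z : ob).

Definition isomorphic a b : Prop :=
  exists (f : hom C a b) (g : hom C b a), comp g f = idm C a /\ comp f g = idm C b.

Definition is_mono a b (f : hom C a b) : Prop :=
  forall x (h k : hom C x a), comp f h = comp f k -> h = k.

Definition is_epi a b (f : hom C a b) : Prop :=
  forall x (h k : hom C b x), comp h f = comp k f -> h = k.

Definition is_zero z : Prop :=
  forall x, (exists! f : hom C z x, True) /\ (exists! f : hom C x z, True).

Definition is_zero_mor a b (f : hom C a b) : Prop :=
  exists z (g : hom C z b) (h : hom C a z), is_zero z /\ f = comp g h.

Definition is_kernel a b c (g : hom C b c) (k : hom C a b) : Prop :=
  is_zero_mor (comp g k) /\
  forall x (h : hom C x b), is_zero_mor (comp g h) ->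
    exists! u : hom C x a, comp k u = h.

Definition is_cokernel a b c (f : hom C a b) (q : hom C b c) : Prop :=
  is_zero_mor (comp q f) /\
  forall x (h : hom C b x), is_zero_mor (comp h f) ->
    exists! u : hom C c x, comp u q = h.

Definition is_image a b i (f : hom C a b) (m : hom C i b) : Prop :=
  exists c (q : hom C b c), is_cokernel f q /\ is_kernel q m.

(** Exactness at [b]: the image of [f] and the kernel of [g] are the same
    subobject of [b], i.e. some [m] represents both. *)
Definition exact_at a b c (f : hom C a b) (g : hom C b c) : Prop :=
  exists i (m : hom C i b), is_image f m /\ is_kernel g m.

(** [0 -> a -> b -> c -> 0] is exact at [a], [b] and [c]. *)
Definition short_exact a b c (f : hom C a b) (g : hom C b c) : Prop :=
  exists z (i : hom C z a) (j : hom C c z),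
    [/\ is_zero z, exact_at i f, exact_at f g & exact_at g j].

Record preadditive : Type := Preadditive {
  hadd : forall a b, hom C a b -> hom C a b -> hom C a b;
  hzero : forall a b, hom C a b;
  hopp : forall a b, hom C a b -> hom C a b;
  haddA : forall a b (f g h : hom C a b), hadd f (hadd g h) = hadd (hadd f g) h;
  haddC : forall a b (f g : hom C a b), hadd f g = hadd g f;
  hadd0 : forall a b (f : hom C a b), hadd (hzero a b) f = f;
  haddN : forall a b (f : hom C a b), hadd (hopp f) f = hzero a b;
  compDl : forall a b c (g h : hom C b c) (f : hom C a b),
    comp (hadd g h) f = hadd (comp g f) (comp h f);
  compDr : forall a b c (h : hom C b c) (f g : hom C a b),
    comp h (hadd f g) = hadd (comp h f) (comp h g)
}.

Definition is_biproduct (S : preadditive) a b s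
    (i1 : hom C a s) (i2 : hom C b s) (p1 : hom C s a) (p2 : hom C s b) : Prop :=
  [/\ comp p1 i1 = idm C a, comp p2 i2 = idm C b &
      hadd S (comp i1 p1) (comp i2 p2) = idm C s].

Record abelian : Type := Abelian {
  ab_preadditive : preadditive;
  ab_zero : exists z, is_zero z;
  ab_biproduct : forall a b, exists s (i1 : hom C a s) (i2 : hom C b s)
      (p1 : hom C s a) (p2 : hom C s b),
    is_biproduct ab_preadditive i1 i2 p1 p2;
  ab_kernel : forall b c (g : hom C b c),
    exists a (k : hom C a b), is_kernel g k;
  ab_cokernel : forall a b (f : hom C a b),
    exists c (q : hom C b c), is_cokernel f q;
  ab_mono : forall a b (m : hom C a b), is_mono m ->
    exists c (g : hom C b c), is_kernel g m;
  ab_epi : forall b c (e : hom C b c), is_epi e ->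
    exists a (f : hom C a b), is_cokernel f e
}.

Variable R : realType.
Implicit Types (O : ob -> Prop) (w : ob -> \bar R).

(** Weights make sense over any category, so that the same definition applies
    to an abelian category and to its categories of functors. [w] is total on
    [ob], but only its values on [O] matter. *)
Record is_weight O w : Prop := IsWeight {
  class_zero : exists2 z, is_zero z & O z;
  class_iso : forall a b, isomorphic a b -> O a -> O b;
  weight_ge0 : forall a, O a -> (0 <= w a)%E;
  weight_zero : forall z, is_zero z -> O z -> w z = 0%E;
  weight_iso : forall a b, isomorphic a b -> O a -> O b -> w a = w b
}.

Definition is_exact O w : Prop :=
  forall a b c (f : hom C a b) (g : hom C b c),
    short_exact f g -> O a -> O b -> O c ->
    [/\ (w a <= w b + w c)%E, (w b <= w a + w c)%E & (w c <= w a + w b)%E].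

End CategoryNotions.

Section FunctorCategory.
Variables (obP obA : Type) (P : category obP) (A : category obA).

Record functor : Type := Functor {
  fobj :> obP -> obA;
  fmor : forall p q, hom P p q -> hom A (fobj p) (fobj q);
  fmor1 : forall p, fmor (idm P p) = idm A (fobj p);
  fmorM : forall p q r (g : hom P q r) (f : hom P p q),
    fmor (comp g f) = comp (fmor g) (fmor f)
}.

Record nattrans (M N : functor) : Type := NatTrans {
  ntapp :> forall p, hom A (M p) (N p);
  ntnat : forall p q (f : hom P p q),
    comp (ntapp q) (fmor M f) = comp (fmor N f) (ntapp p)
}.

Lemma nattransP (M N : functor) (s t : nattrans M N) :
  (forall p, s p = t p) -> s = t.
Proof.
case: s t => [s hs] [t ht] /= st.
have {}st : s = t by apply: functional_extensionality_dep.
by subst t; congr NatTrans; exact: Prop_irrelevance.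
Qed.

Definition nattrans_id (M : functor) : nattrans M M.
Proof.
exists (fun p => idm A (M p)) => p q f.
by rewrite comp1m compm1.
Defined.

Definition nattrans_comp (L M N : functor)
  (t : nattrans M N) (s : nattrans L M) : nattrans L N.
Proof.
exists (fun p => comp (t p) (s p)) => p q f.
by rewrite -compA ntnat !compA ntnat.
Defined.

Definition functor_category : category functor.
Proof.
apply: (@Category functor nattrans nattrans_id nattrans_comp).
- by move=> M N s; apply: nattransP => p; exact: comp1m.
- by move=> M N s; apply: nattransP => p; exact: compm1.
- by move=> K L M N u t s; apply: nattransP => p; exact: compA.
Defined.

End FunctorCategory.

(** A [measurableType] is inhabited. So that the small category [P] may be
    empty, its set of objects is a measurable subset [D] of a measurable type
    ([D = setT] if [P] is nonempty), with the induced measure. *)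
Section IntegratedWeight.
Variables (d : measure_display) (T : measurableType d) (R : realType).
Variables (mu : {measure set T -> \bar R}) (D : set T).
Variables (obA : Type) (P : category D) (A : category obA).
Variables (O : obA -> Prop) (w : obA -> \bar R).

(** The function [p |-> w (M p)] on [D]; ['valL_0] extends it by [0] to [T],
    as the library's integral over [D] requires. *)
Definition weight_fun (M : functor P A) : T -> \bar R :=
  'valL_(0%E : \bar R) (fun p : D => w (M p)).

Definition integrable_modules (M : functor P A) : Prop :=
  (forall p, O (M p)) /\ mu.-integrable D (weight_fun M).

Definition integrated_weight (M : functor P A) : \bar R :=
  (\int[mu]_(p in D) weight_fun M p)%E.

End IntegratedWeight.

(* Main.v *)
(** Zero objects, kernels and cokernels in a functor category to an abelian
    category can be computed objectwise. Hence evaluation at each object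
    preserves short exact sequences, and each of the three inequalities follows
    by integrating the pointwise inequality given by the exactness of [w]. *)

Require Import Defs.
From HB Require Import structures.
From mathcomp Require Import all_boot all_order all_algebra.
From mathcomp Require Import all_classical all_reals all_analysis.

Set Implicit Arguments.
Unset Strict Implicit.
Unset Printing Implicit Defensive.

Local Open Scope classical_set_scope.
Local Open Scope ring_scope.

(** Serves to assemble natural transformations from objectwise existence statements: the type of a
    component depends on the object, so the choice is dependent. *)
Lemma dep_choice (I : Type) (Y : I -> Type) (Q : forall i, Y i -> Prop) :
  (forall i, exists y, Q i y) -> exists f, forall i, Q i (f i).
Proof.
by move=> QP; exists (fun i => sval (cid (QP i))) => i; exact: svalP.
Qed.

(** * Zero objects, kernels and cokernels in an arbitrary category *)

Section Category.
Variables (ob : Type) (C : category ob).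

Lemma hom_from_zero_eq (z x : ob) (f g : Defs.hom C z x) :
  is_zero C z -> f = g.
Proof. by move=> /(_ x)[[h [_ hu]] _]; rewrite -(hu f I) -(hu g I). Qed.

Lemma hom_to_zero_eq (z x : ob) (f g : Defs.hom C x z) :
  is_zero C z -> f = g.
Proof. by move=> /(_ x)[_ [h [_ hu]]]; rewrite -(hu f I) -(hu g I). Qed.

Lemma is_zero_isomorphic (z z' : ob) :
  isomorphic C z z' -> is_zero C z -> is_zero C z'.
Proof.
move=> [f [g [_ fg]]] z0 x; split.
- have [[h _] _] := z0 x; exists (Defs.comp h g); split=> // k _.
  rewrite -(compm1 k) -fg Defs.compA; congr Defs.comp.
  exact: hom_from_zero_eq.
- have [_ [h _]] := z0 x; exists (Defs.comp f h); split=> // k _.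
  rewrite -(comp1m k) -fg -Defs.compA; congr Defs.comp.
  exact: hom_to_zero_eq.
Qed.

Lemma zeros_isomorphic (z z' : ob) :
  is_zero C z -> is_zero C z' -> isomorphic C z z'.
Proof.
move=> z0 z'0; have [[f _] _] := z0 z'; have [[g _] _] := z'0 z.
by exists f, g; split; exact: hom_from_zero_eq.
Qed.

Lemma is_zero_mor_compr (a b c : ob) (f : Defs.hom C b c) (g : Defs.hom C a b) :
  is_zero_mor f -> is_zero_mor (Defs.comp f g).
Proof.
move=> [z [h [k [z0 ->]]]]; exists z, h, (Defs.comp k g).
by rewrite Defs.compA.
Qed.

Lemma is_zero_mor_compl (a b c : ob) (f : Defs.hom C b c) (g : Defs.hom C a b) :
  is_zero_mor g -> is_zero_mor (Defs.comp f g).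
Proof.
move=> [z [h [k [z0 ->]]]]; exists z, (Defs.comp f h), k.
by rewrite Defs.compA.
Qed.

(** If [comp k u] and [comp k v] agree, then [u] and [v] are both factorizations through [k] of one
    morphism killed by [g], and such a factorization is unique. *)
Lemma kernel_mono (a b c : ob) (g : Defs.hom C b c) (k : Defs.hom C a b) :
  is_kernel g k -> is_mono k.
Proof.
move=> [gk0 ker] x u v uv.
have := is_zero_mor_compr u gk0; rewrite -Defs.compA => /ker[t [_ tu]].
by rewrite -(tu u erefl) -(tu v (esym uv)).
Qed.

Lemma cokernel_epi (a b c : ob) (f : Defs.hom C a b) (q : Defs.hom C b c) :
  is_cokernel f q -> is_epi q.
Proof.
move=> [qf0 coker] x u v uv.
have := is_zero_mor_compl u qf0; rewrite Defs.compA => /coker[t [_ tu]].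
by rewrite -(tu u erefl) -(tu v (esym uv)).
Qed.

(** Used together with [kernel_unique] to compare an arbitrary kernel in a functor category with one
    built objectwise. *)
Lemma kernel_iso (a a' b c : ob) (g : Defs.hom C b c) (k : Defs.hom C a b)
    (u : Defs.hom C a' a) (v : Defs.hom C a a') :
  Defs.comp v u = idm C a' -> Defs.comp u v = idm C a ->
  is_kernel g k -> is_kernel g (Defs.comp k u).
Proof.
move=> vu uv [gk0 ker]; split.
  by rewrite Defs.compA; exact: is_zero_mor_compr.
move=> x h /ker[t [kt tu]]; exists (Defs.comp v t); split.
  by rewrite -Defs.compA (Defs.compA u) uv comp1m.
move=> s ks; have /tu -> : Defs.comp k (Defs.comp u s) = h.
  by rewrite Defs.compA.
by rewrite Defs.compA vu comp1m.
Qed.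

Lemma cokernel_iso (a b c c' : ob) (f : Defs.hom C a b) (q : Defs.hom C b c)
    (u : Defs.hom C c c') (v : Defs.hom C c' c) :
  Defs.comp v u = idm C c -> Defs.comp u v = idm C c' ->
  is_cokernel f q -> is_cokernel f (Defs.comp u q).
Proof.
move=> vu uv [qf0 coker]; split.
  by rewrite -Defs.compA; exact: is_zero_mor_compl.
move=> x h /coker[t [tq tu]]; exists (Defs.comp t v); split.
  by rewrite Defs.compA -(Defs.compA t) vu compm1.
move=> s sq; have /tu -> : Defs.comp (Defs.comp s u) q = h.
  by rewrite -Defs.compA.
by rewrite -Defs.compA uv compm1.
Qed.

Lemma kernel_unique (a a' b c : ob) (g : Defs.hom C b c)
    (k : Defs.hom C a b) (k' : Defs.hom C a' b) :
  is_kernel g k -> is_kernel g k' ->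
  exists (u : Defs.hom C a' a) (v : Defs.hom C a a'),
    [/\ Defs.comp k u = k', Defs.comp v u = idm C a' &
        Defs.comp u v = idm C a].
Proof.
move=> kerk kerk'.
have [u [ku _]] := kerk.2 _ _ kerk'.1.
have [v [kv _]] := kerk'.2 _ _ kerk.1.
exists u, v; split=> //.
(* Each composite of [u] and [v] fixes a kernel map, which is monic, so it is an identity. *)
- by apply: (kernel_mono kerk'); rewrite Defs.compA kv ku compm1.
- by apply: (kernel_mono kerk); rewrite Defs.compA ku kv compm1.
Qed.

Lemma cokernel_unique (a b c c' : ob) (f : Defs.hom C a b)
    (q : Defs.hom C b c) (q' : Defs.hom C b c') :
  is_cokernel f q -> is_cokernel f q' ->
  exists (u : Defs.hom C c c') (v : Defs.hom C c' c),
    [/\ Defs.comp u q = q', Defs.comp v u = idm C c &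
        Defs.comp u v = idm C c'].
Proof.
move=> cokq cokq'.
have [u [uq _]] := cokq.2 _ _ cokq'.1.
have [v [vq _]] := cokq'.2 _ _ cokq.1.
exists u, v; split=> //.
- by apply: (cokernel_epi cokq); rewrite -Defs.compA uq vq comp1m.
- by apply: (cokernel_epi cokq'); rewrite -Defs.compA vq uq comp1m.
Qed.

End Category.

(** * Objectwise zero objects, kernels and cokernels in a functor category *)

Section FunctorCategory.
Variables (obP obA : Type) (P : category obP) (A : category obA).
Local Notation fcat := (functor_category P A).

Lemma isomorphic_ev (M N : functor P A) :
  isomorphic fcat M N -> forall p, isomorphic A (M p) (N p).
Proof.
move=> [f [g [gf fg]]] p.
exists ((f : nattrans M N) p), ((g : nattrans N M) p); split.
- exact: (congr1 (fun s : nattrans M M => s p) gf).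
- exact: (congr1 (fun s : nattrans N N => s p) fg).
Qed.

Definition const_functor (a : obA) : functor P A :=
  @Functor _ _ P A (fun=> a) (fun _ _ _ => idm A a) (fun=> erefl)
    (fun _ _ _ _ _ => esym (comp1m (idm A a))).

(** Components and their naturality come for free, since any two parallel morphisms out of or into a
    zero object are equal. *)
Lemma functor_is_zero (Z : functor P A) :
  (forall p, is_zero A (Z p)) -> is_zero fcat Z.
Proof.
move=> Z0 M; split.
- have [s _] := dep_choice (fun p => (Z0 p (M p)).1).
  have sN p q (f : Defs.hom P p q) :
      Defs.comp (s q) (fmor Z f) = Defs.comp (fmor M f) (s p).
    exact: hom_from_zero_eq.
  exists (NatTrans sN); split=> // t _.
  by apply: nattransP => p; exact: hom_from_zero_eq.
- have [s _] := dep_choice (fun p => (Z0 p (M p)).2).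
  have sN p q (f : Defs.hom P p q) :
      Defs.comp (s q) (fmor M f) = Defs.comp (fmor Z f) (s p).
    exact: hom_to_zero_eq.
  exists (NatTrans sN); split=> // t _.
  by apply: nattransP => p; exact: hom_to_zero_eq.
Qed.

Hypothesis zeroA : exists z, is_zero A z.

(** A zero functor is isomorphic to the constant functor at a zero object of [A], and evaluation
    preserves isomorphisms. *)
Lemma is_zero_ev (Z : functor P A) :
  is_zero fcat Z -> forall p, is_zero A (Z p).
Proof.
move=> Z0 p; have [z z0] := zeroA.
have c0 : is_zero fcat (const_functor z) by exact: functor_is_zero.
exact: (is_zero_isomorphic (isomorphic_ev (zeros_isomorphic c0 Z0) p)).
Qed.

Lemma is_zero_mor_ev (M N : functor P A) (s : nattrans M N) :
  is_zero_mor (C := fcat) s -> forall p, is_zero_mor (s p).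
Proof.
move=> [Z [g [h [Z0 ->]]]] p.
exists (Z p), ((g : nattrans Z N) p), ((h : nattrans M Z) p).
by split=> //; exact: is_zero_ev.
Qed.

(** The zero objects through which the components factor may vary with [p] without forming a
    functor; they are all replaced by one constant zero functor. *)
Lemma functor_is_zero_mor (M N : functor P A) (s : nattrans M N) :
  (forall p, is_zero_mor (s p)) -> is_zero_mor (C := fcat) s.
Proof.
move=> s0; have [z z0] := zeroA.
have c0 : is_zero fcat (const_functor z) by exact: functor_is_zero.
have [[g _] _] := c0 N; have [_ [h _]] := c0 M.
exists (const_functor z), g, h; split=> //; apply: nattransP => p /=.
have [z' [u [v [z'0 ->]]]] := s0 p.
have [[i _] _] := z'0 z.
(* Both morphisms start at the zero object [z'], so the factorization through [z'] is rerouted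
   through [z]. *)
rewrite (hom_from_zero_eq u
  (Defs.comp ((g : nattrans (const_functor z) N) p) i) z'0).
by rewrite -Defs.compA; congr Defs.comp; exact: hom_to_zero_eq.
Qed.

(** The objectwise factorizations [u p] are natural because naturality may be checked after
    composing with the monic [k q], where it becomes naturality of [k] and [h]. *)
Lemma functor_is_kernel (K M N : functor P A) (g : nattrans M N)
    (k : nattrans K M) :
  (forall p, is_kernel (g p) (k p)) -> is_kernel (C := fcat) g k.
Proof.
move=> ker; split.
  by apply: functor_is_zero_mor => p; exact: (ker p).1.
move=> X h /is_zero_mor_ev gh0.
have [u uP] := dep_choice (fun p => (ker p).2 _ _ (gh0 p)).
have uN p q (f : Defs.hom P p q) :
    Defs.comp (u q) (fmor X f) = Defs.comp (fmor K f) (u p).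
  apply: (kernel_mono (ker q)).
  rewrite !Defs.compA (uP q).1 (ntnat k) -Defs.compA (uP p).1.
  exact: (ntnat (h : nattrans X M)).
exists (NatTrans uN); split.
  by apply: nattransP => p; exact: (uP p).1.
move=> v kv; apply: nattransP => p; apply: (uP p).2.
exact: (congr1 (fun s : nattrans X M => s p) kv).
Qed.

(** Dual argument: naturality is checked after precomposing with the epic [q p]. *)
Lemma functor_is_cokernel (L M Q : functor P A) (f : nattrans L M)
    (q : nattrans M Q) :
  (forall p, is_cokernel (f p) (q p)) -> is_cokernel (C := fcat) f q.
Proof.
move=> coker; split.
  by apply: functor_is_zero_mor => p; exact: (coker p).1.
move=> X h /is_zero_mor_ev hf0.
have [u uP] := dep_choice (fun p => (coker p).2 _ _ (hf0 p)).
have uN p r (e : Defs.hom P p r) :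
    Defs.comp (u r) (fmor Q e) = Defs.comp (fmor X e) (u p).
  apply: (cokernel_epi (coker p)).
  rewrite -!Defs.compA (uP p).1 -(ntnat q) Defs.compA (uP r).1.
  exact: (ntnat (h : nattrans M X)).
exists (NatTrans uN); split.
  by apply: nattransP => p; exact: (uP p).1.
move=> v vq; apply: nattransP => p; apply: (uP p).2.
exact: (congr1 (fun s : nattrans M X => s p) vq).
Qed.

(** Chosen kernels form a functor: each [fmor M f] restricts to them by the universal property, and
    monicity of the kernel maps forces identities and composites to be preserved. *)
Lemma objectwise_kernel (M N : functor P A) (g : nattrans M N) :
  (forall p, exists a (k : Defs.hom A a (M p)), is_kernel (g p) k) ->
  exists (K : functor P A) (k : nattrans K M),
    forall p, is_kernel (g p) (k p).
Proof.
move=> /choice[K0 /dep_choice[k ker]].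
have lift p q (f : Defs.hom P p q) :
    exists u, Defs.comp (k q) u = Defs.comp (fmor M f) (k p).
  (* Naturality of [g] turns this composite into [fmor N f] after [comp (g p) (k p)], which is a
     zero morphism. *)
  have /(ker q).2[u [ku _]] :
      is_zero_mor (Defs.comp (g q) (Defs.comp (fmor M f) (k p))).
    rewrite Defs.compA ntnat -Defs.compA.
    exact: is_zero_mor_compl (ker p).1.
  by exists u.
pose Kf p q (f : Defs.hom P p q) := sval (cid (lift p q f)).
have KfE p q (f : Defs.hom P p q) :
    Defs.comp (k q) (Kf p q f) = Defs.comp (fmor M f) (k p).
  exact: svalP (cid (lift p q f)).
have Kf1 p : Kf p p (idm P p) = idm A (K0 p).
  by apply: (kernel_mono (ker p)); rewrite KfE fmor1 comp1m compm1.
have KfM p q r (e : Defs.hom P q r) (f : Defs.hom P p q) :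
    Kf p r (Defs.comp e f) = Defs.comp (Kf q r e) (Kf p q f).
  apply: (kernel_mono (ker r)).
  by rewrite Defs.compA !KfE fmorM -!Defs.compA KfE.
by exists (Functor Kf1 KfM), (@NatTrans _ _ _ _ (Functor Kf1 KfM) M k KfE).
Qed.

(** Dual construction: each [fmor M e] descends to the chosen cokernels, and functoriality follows
    because the maps [q p] are epic. *)
Lemma objectwise_cokernel (L M : functor P A) (f : nattrans L M) :
  (forall p, exists c (q : Defs.hom A (M p) c), is_cokernel (f p) q) ->
  exists (Q : functor P A) (q : nattrans M Q),
    forall p, is_cokernel (f p) (q p).
Proof.
move=> /choice[Q0 /dep_choice[q coker]].
have desc p r (e : Defs.hom P p r) :
    exists u, Defs.comp u (q p) = Defs.comp (q r) (fmor M e).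
  have /(coker p).2[u [uq _]] :
      is_zero_mor (Defs.comp (Defs.comp (q r) (fmor M e)) (f p)).
    rewrite -Defs.compA -ntnat Defs.compA.
    exact: is_zero_mor_compr (coker r).1.
  by exists u.
pose Qf p r (e : Defs.hom P p r) := sval (cid (desc p r e)).
have QfE p r (e : Defs.hom P p r) :
    Defs.comp (Qf p r e) (q p) = Defs.comp (q r) (fmor M e).
  exact: svalP (cid (desc p r e)).
have Qf1 p : Qf p p (idm P p) = idm A (Q0 p).
  by apply: (cokernel_epi (coker p)); rewrite QfE fmor1 comp1m compm1.
have QfM p r s (e' : Defs.hom P r s) (e : Defs.hom P p r) :
    Qf p s (Defs.comp e' e) = Defs.comp (Qf r s e') (Qf p r e).
  apply: (cokernel_epi (coker p)).
  by rewrite -Defs.compA !QfE fmorM !Defs.compA QfE.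
exists (Functor Qf1 QfM).
by exists (@NatTrans _ _ _ _ M (Functor Qf1 QfM) q
  (fun p r e => esym (QfE p r e))).
Qed.

End FunctorCategory.

(** * Evaluation preserves exactness when the target is abelian *)

Section AbelianTarget.
Variables (obP obA : Type) (P : category obP) (A : category obA).
Hypothesis abA : abelian A.
Local Notation fcat := (functor_category P A).

Lemma is_kernel_ev (K M N : functor P A) (g : nattrans M N)
    (k : nattrans K M) :
  is_kernel (C := fcat) g k -> forall p, is_kernel (g p) (k p).
Proof.
move=> kerk p.
have [K' [k' ker']] := objectwise_kernel (fun p => ab_kernel abA (g p)).
(* By uniqueness of kernels, [k] is rewritten as the objectwise kernel [k'] composed with an
   isomorphism [u], whose components are again isomorphisms. *)
have [u [v [<- vu uv]]] :=
  kernel_unique (functor_is_kernel (ab_zero abA) ker') kerk.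
apply: (@kernel_iso _ _ _ _ _ _ _ _ _ ((v : nattrans K' K) p)) (ker' p).
- exact: (congr1 (fun s : nattrans K K => s p) vu).
- exact: (congr1 (fun s : nattrans K' K' => s p) uv).
Qed.

Lemma is_cokernel_ev (L M Q : functor P A) (f : nattrans L M)
    (q : nattrans M Q) :
  is_cokernel (C := fcat) f q -> forall p, is_cokernel (f p) (q p).
Proof.
move=> cokq p.
have [Q' [q' cok']] := objectwise_cokernel (fun p => ab_cokernel abA (f p)).
have [u [v [<- vu uv]]] :=
  cokernel_unique (functor_is_cokernel (ab_zero abA) cok') cokq.
apply: (@cokernel_iso _ _ _ _ _ _ _ _ _ ((v : nattrans Q Q') p)) (cok' p).
- exact: (congr1 (fun s : nattrans Q' Q' => s p) vu).
- exact: (congr1 (fun s : nattrans Q Q => s p) uv).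
Qed.

(** Exactness is phrased through kernels and a cokernel only, so the same witnesses, evaluated at
    [p], work. *)
Lemma exact_at_ev (L M N : functor P A) (f : nattrans L M)
    (g : nattrans M N) :
  exact_at (C := fcat) f g -> forall p, exact_at (f p) (g p).
Proof.
move=> [I [m [[Q [q [cok ker]]] ker']]] p.
exists (I p), ((m : nattrans I M) p); split; last exact: is_kernel_ev ker' p.
exists (Q p), ((q : nattrans M Q) p); split.
- exact: is_cokernel_ev cok p.
- exact: is_kernel_ev ker p.
Qed.

Lemma short_exact_ev (L M N : functor P A) (f : nattrans L M)
    (g : nattrans M N) :
  short_exact (C := fcat) f g -> forall p, short_exact (f p) (g p).
Proof.
move=> [Z [i [j [Z0 fex mex gex]]]] p.
exists (Z p), ((i : nattrans Z L) p), ((j : nattrans N Z) p).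
split; [exact: is_zero_ev (ab_zero abA) _ Z0 p | | |]; exact: exact_at_ev.
Qed.

End AbelianTarget.

(** * Integration of weights over the set of objects *)

Section IntegratedWeight.
Variables (d : measure_display) (T : measurableType d) (R : realType).
Variables (mu : {measure set T -> \bar R}) (D : set T).
Variables (obA : Type) (P : category D) (A : category obA).
Variables (O : obA -> Prop) (w : obA -> \bar R).
Implicit Types L M N : functor P A.

Lemma weight_fun_val M (p : D) : weight_fun w M (val p) = w (M p).
Proof.
exact: (congr1 (fun F => F (fun p : D => w (M p)) p) (sigL_valL 0%E (A := D))).
Qed.

(** Reduces claims about points of [D] to elements of the subtype, where [weight_fun] is given by
    [w] and not by its default value. *)
Lemma in_dom_val (x : T) : D x -> exists p : D, x = val p.
Proof. by move=> Dx; exists (exist _ x (mem_set Dx)). Qed.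

Lemma eq_weight_fun M N :
  (forall p, w (M p) = w (N p)) -> weight_fun w M = weight_fun w N.
Proof.
by move=> MN; rewrite /weight_fun; congr ('valL_ _ _); exact/funext.
Qed.

(** Integrability gives additivity and monotonicity of the integral. The roles of the three modules
    are left free, so that one statement yields all three inequalities of exactness. *)
Lemma integrated_weight_le (mD : measurable D) L M N :
  integrable_modules mu O w L -> integrable_modules mu O w M ->
  integrable_modules mu O w N ->
  (forall p, w (L p) <= w (M p) + w (N p))%E ->
  (integrated_weight mu w L <=
   integrated_weight mu w M + integrated_weight mu w N)%E.
Proof.
move=> [_ iL] [_ iM] [_ iN] LMN.
rewrite /integrated_weight -integralD //; apply: le_integral => //.
  exact: integrableD.
move=> _ /set_mem /in_dom_val[p ->].
by rewrite !weight_fun_val.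
Qed.

Lemma is_weight_integrated (mD : measurable D) :
  (exists z, is_zero A z) -> is_weight A O w ->
  is_weight (functor_category P A)
    (integrable_modules mu O w) (integrated_weight mu w).
Proof.
move=> zeroA wO.
have weight_iso_ev M N : isomorphic (functor_category P A) M N ->
    (forall p, O (M p)) -> weight_fun w M = weight_fun w N.
  move=> /isomorphic_ev MN OM; apply: eq_weight_fun => p.
  (* Closure of [O] under isomorphism supplies [O (N p)], which invariance of [w] requires. *)
  exact: (weight_iso wO (MN p) (OM p) (class_iso wO (MN p) (OM p))).
split.
- have [z z0 Oz] := class_zero wO.
  exists (const_functor P A z); first exact: functor_is_zero.
  (* The weight function of the constant functor at [z] vanishes on [D], so its integrability is
     that of the zero function. *)
  split=> //; apply: eq_integrable (integrable0 mu D) => //.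
  move=> _ /set_mem /in_dom_val[p ->].
  by rewrite weight_fun_val (weight_zero wO z0).
- move=> M N MN [OM iM]; split.
    by move=> p; apply: (class_iso wO (isomorphic_ev MN p)); exact: OM.
  by rewrite -(weight_iso_ev M N).
- move=> M [OM _]; apply: integral_ge0 => _ /in_dom_val[p ->].
  by rewrite weight_fun_val (weight_ge0 wO).
- move=> Z /(is_zero_ev zeroA) Z0 [OZ _]; apply: integral0_eq => _ /in_dom_val[p ->].
  by rewrite weight_fun_val (weight_zero wO).
- by move=> M N MN [OM _] _; rewrite /integrated_weight (weight_iso_ev M N).
Qed.

Lemma is_exact_integrated (mD : measurable D) :
  abelian A -> is_exact A O w ->
  is_exact (functor_category P A)
    (integrable_modules mu O w) (integrated_weight mu w).
Proof.
move=> abA wE L M N f g /(short_exact_ev abA) fg iL iM iN.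
have wLMN p := wE _ _ _ _ _ (fg p) (iL.1 p) (iM.1 p) (iN.1 p).
by split; apply: integrated_weight_le => // p; have [] := wLMN p.
Qed.

End IntegratedWeight.

Theorem lemma4p2 (R : realType)
  (d : measure_display) (T : measurableType d)
  (mu : {measure set T -> \bar R}) (D : set T) (mD : measurable D)
  (P : category D)
  (obA : Type) (A : category obA) (abA : abelian A)
  (O : obA -> Prop) (w : obA -> \bar R) :
  is_weight A O w ->
  is_exact A O w ->
  is_weight (functor_category P A)
    (integrable_modules mu O w) (integrated_weight mu w) /\
  is_exact (functor_category P A)
    (integrable_modules mu O w) (integrated_weight mu w).
Proof.
move=> wO wE; split.
- exact: is_weight_integrated mD (ab_zero abA) wO.
- exact: is_exact_integrated mD abA wE.
Qed.
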